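(* Let $f_1,\dots,f_n:\mathbb{R}^d\to\mathbb{R}$ be differentiable (possibly non-convex) and let $f=\frac1n\sum_{i=1}^n f_i$. Suppose that $f$ and $f_1,\dots,f_n$ are all $L$-smooth, that $f$ is bounded from below by $f_\ast\in\mathbb{R}$, and that there are constants $A,B\ge0$ such that for all $x\in\mathbb{R}^d$ $$\frac1n\sum_{i=1}^n\|\nabla f_i(x)-\nabla f(x)\|^2\le 2A\,(f(x)-f_\ast)+B^2.$$ Then for Random Reshuffling run for $T\ge 1$ epochs from $x_0\in\mathbb{R}^d$ with a stepsize $0<\gamma\le\min\left(\frac{1}{2Ln},\frac{1}{(AL^2n^2T)^{1/3}}\right)$ we have $$\min_{t=0,\dots,T-1}\mathbb{E}\left[\|\nabla f(x_t)\|^2\right]\le\frac{12\,(f(x_0)-f_\ast)}{\gamma nT}+2\gamma^2L^2nB^2.$$ If, in addition, $A=0$ and $f$ satisfies the Polyak-{\L}ojasiewicz inequality with $\mu>0$, i.e. $\|\nabla f(x)\|^2\ge2\mu(f(x)-f_\ast)$ for all $x\in\mathbb{R}^d$, then, with $\kappa=L/\mu$, $$\mathbb{E}\left[f(x_T)-f_\ast\right]\le\left(1-\frac{\gamma\mu n}{2}\right)^T(f(x_0)-f_\ast)+\gamma^2\kappa LnB^2.$$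
   Context: $L$-smooth means that the gradient is $L$-Lipschitz. When $A=0$, the quantity $1/(AL^2n^2T)^{1/3}$ is read as $+\infty$. Random Reshuffling (RR): given a stepsize $\gamma>0$, a starting point $x_0\in\mathbb{R}^d$ and a number of epochs $T$, in each epoch $t=0,1,\dots,T-1$ sample afresh (independently) a uniformly random permutation $\pi=(\pi_0,\pi_1,\dots,\pi_{n-1})$ of $\{1,\dots,n\}$, set $x_t^0=x_t$, perform $x_t^{i+1}=x_t^i-\gamma\nabla f_{\pi_i}(x_t^i)$ for $i=0,1,\dots,n-1$, and set $x_{t+1}=x_t^n$. The expectation is over the random permutations. *)

(* Defs.v *)
From mathcomp Require Export all_boot all_order all_algebra all_fingroup.
From mathcomp Require Export all_classical all_reals all_analysis.
Export Order.TTheory GRing.Theory Num.Theory numFieldNormedType.Exports.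

Set Implicit Arguments.
Unset Strict Implicit.
Unset Printing Implicit Defensive.

Local Open Scope classical_set_scope.
Local Open Scope ring_scope.

(* The library norm on 'rV[R]_d is the sup norm; it induces the same notion of
   differentiability, but the norm in the inequalities is the Euclidean one. *)
Definition enorm (R : realType) (d : nat) (v : 'rV[R]_d) : R :=
  Num.sqrt (\sum_(j < d) v ord0 j ^+ 2).

Definition grad (R : realType) (d : nat) (g : 'rV[R]_d -> R) (x : 'rV[R]_d) :
    'rV[R]_d :=
  \row_(j < d) 'D_(delta_mx ord0 j) (g : 'rV[R]_d -> R^o) x.

Definition smooth (R : realType) (d : nat) (L : R) (g : 'rV[R]_d -> R) : Prop :=
  (forall x, differentiable (g : 'rV[R]_d -> R^o) x) /\
  (forall x y, enorm (grad g x - grad g y) <= L * enorm (x - y)).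

Definition favg (R : realType) (d n : nat) (f : 'I_n -> 'rV[R]_d -> R) :
    'rV[R]_d -> R :=
  fun x => n%:R^-1 * \sum_(i < n) f i x.

Definition polyak_lojasiewicz (R : realType) (d : nat) (mu fstar : R)
    (g : 'rV[R]_d -> R) : Prop :=
  forall x, enorm (grad g x) ^+ 2 >= 2 * mu * (g x - fstar).

(* [enum 'I_n] is 0, 1, ..., n-1 in increasing order. *)
Definition rr_epoch (R : realType) (d n : nat) (f : 'I_n -> 'rV[R]_d -> R)
    (gamma : R) (s : 'S_n) (x : 'rV[R]_d) : 'rV[R]_d :=
  foldl (fun y i => y - gamma *: grad (f (s i)) y) x (enum 'I_n).

Fixpoint rr_iter (R : realType) (d n : nat) (f : 'I_n -> 'rV[R]_d -> R)
    (gamma : R) (x0 : 'rV[R]_d) (s : nat -> 'S_n) (t : nat) : 'rV[R]_d :=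
  if t is t'.+1 then rr_epoch f gamma (s t') (rr_iter f gamma x0 s t') else x0.

(* Random elements of a type S whose subsets all count as measurable
   (below, S is the finite set 'S_n). *)
Definition discrete_random (disp : measure_display)
    (Omega : measurableType disp) (S : Type) (X : Omega -> S) : Prop :=
  forall A : set S, measurable (X @^-1` A).

Definition mutually_independent (disp : measure_display)
    (Omega : measurableType disp) (R : realType) (P : probability Omega R)
    (I : finType) (S : Type) (X : I -> Omega -> S) : Prop :=
  forall (J : {set I}) (A : I -> set S),
    P (\bigcap_(i in [set i | i \in J]) X i @^-1` A i) =
    (\prod_(i in J) P (X i @^-1` A i))%E.

(* Only the first T permutations p 0, ..., p (T - 1) are constrained. *)
Definition independent_uniform_perms (disp : measure_display)
    (Omega : measurableType disp) (R : realType) (P : probability Omega R)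
    (n T : nat) (p : nat -> Omega -> 'S_n) : Prop :=
  [/\ forall t : 'I_T, discrete_random (p t),
      forall (t : 'I_T) (s : 'S_n), P (p t @^-1` [set s]) = ((n`!)%:R^-1)%:E
    & mutually_independent P (fun t : 'I_T => p t)].

(* Main.v *)
Require Import Defs.
From mathcomp Require Import ring lra zify measurable_realfun.

(* Within an epoch started at x, the iterates drift by V = \sum_k |x^k - x|^2,
   and the descent lemma gives
     f(x') <= f(x) - gamma n/2 |grad f(x)|^2 + gamma L^2/2 V.
   Smoothness bounds V by the partial sums \sum_(i < k) grad f_(pi_i)(x), i.e.
   by sums of k draws without replacement from a fixed family; distinct draws
   are negatively correlated, so the mean squared norm of such a sum is at most
   k^2 |grad f(x)|^2 + k sigma^2. Averaging over the permutation yields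
     E delta' <= (1 + a) delta - b |grad f(x)|^2 + c,   delta = f - fstar,
   with b = 7/18 gamma n, a = 4/3 gamma^3 L^2 n^2 A <= 4/(3T) and
   c = 2/3 gamma^3 L^2 n^2 B^2; both bounds follow by iterating this
   inequality, using (1 + a)^T <= exp (4/3) <= 14/3 in the first case. In the
   Polyak-Lojasiewicz case the contraction factor 1 - 2 b mu is nonnegative
   because mu <= L, unless f is constantly fstar. *)

Set Implicit Arguments.
Unset Strict Implicit.
Unset Printing Implicit Defensive.

Local Open Scope classical_set_scope.
Local Open Scope ring_scope.

(** * Euclidean inner product and norm on row vectors *)

Section Euclidean.
Context {R : realType} {d : nat}.
Implicit Types (u v w : 'rV[R]_d) (a : R).

Definition dotv u v : R := (u *m v^T) ord0 ord0.

Lemma dotvE u v : dotv u v = \sum_(j < d) u ord0 j * v ord0 j.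
Proof. by rewrite /dotv mxE; apply: eq_bigr => j _; rewrite mxE. Qed.

Lemma dotvC u v : dotv u v = dotv v u.
Proof. by rewrite !dotvE; apply: eq_bigr => j _; rewrite mulrC. Qed.

Lemma dotvDl u v w : dotv (u + v) w = dotv u w + dotv v w.
Proof. by rewrite /dotv mulmxDl mxE. Qed.

Lemma dotvNl u w : dotv (- u) w = - dotv u w.
Proof. by rewrite /dotv mulNmx mxE. Qed.

Lemma dotvZl a u w : dotv (a *: u) w = a * dotv u w.
Proof. by rewrite /dotv -scalemxAl mxE. Qed.

Lemma dotvDr u v w : dotv w (u + v) = dotv w u + dotv w v.
Proof. by rewrite !(dotvC w) dotvDl. Qed.

Lemma dotvNr u w : dotv w (- u) = - dotv w u.
Proof. by rewrite !(dotvC w) dotvNl. Qed.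

Lemma dotvZr a u w : dotv w (a *: u) = a * dotv w u.
Proof. by rewrite !(dotvC w) dotvZl. Qed.

Lemma dotv0l w : dotv 0 w = 0.
Proof. by rewrite /dotv mul0mx mxE. Qed.

Lemma dotv_suml (I : Type) (r : seq I) (Q : pred I) (F : I -> 'rV[R]_d) w :
  dotv (\sum_(i <- r | Q i) F i) w = \sum_(i <- r | Q i) dotv (F i) w.
Proof. by rewrite /dotv mulmx_suml summxE. Qed.

Lemma dotv_sumr (I : Type) (r : seq I) (Q : pred I) (F : I -> 'rV[R]_d) w :
  dotv w (\sum_(i <- r | Q i) F i) = \sum_(i <- r | Q i) dotv w (F i).
Proof.
by rewrite dotvC dotv_suml; apply: eq_bigr => i _; rewrite dotvC.
Qed.

Definition dotv_linE :=
  (dotvDl, dotvDr, dotvNl, dotvNr, dotvZl, dotvZr).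

Lemma dotvv_ge0 u : 0 <= dotv u u.
Proof. by rewrite dotvE sumr_ge0// => j _; rewrite -expr2 sqr_ge0. Qed.

Lemma enorm_sqr u : enorm u ^+ 2 = dotv u u.
Proof.
rewrite /enorm sqr_sqrtr ?sumr_ge0// => [|j _]; last exact: sqr_ge0.
by rewrite dotvE; apply: eq_bigr => j _; rewrite expr2.
Qed.

Lemma enorm_ge0 u : 0 <= enorm u.
Proof. exact: sqrtr_ge0. Qed.

Lemma dotv_le_half u v : dotv u v <= (enorm u ^+ 2 + enorm v ^+ 2) / 2.
Proof.
by have := dotvv_ge0 (u - v); rewrite !enorm_sqr !dotv_linE (dotvC v u); lra.
Qed.

Lemma enorm_sqrD u v :
  enorm (u + v) ^+ 2 = enorm u ^+ 2 + 2 * dotv u v + enorm v ^+ 2.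
Proof. by rewrite !enorm_sqr !dotv_linE (dotvC v u); ring. Qed.

Lemma enorm_sqrB u v :
  enorm (u - v) ^+ 2 = enorm u ^+ 2 - 2 * dotv u v + enorm v ^+ 2.
Proof. by rewrite !enorm_sqr !dotv_linE (dotvC v u); ring. Qed.

Lemma enorm_sqrBC u v : enorm (u - v) ^+ 2 = enorm (v - u) ^+ 2.
Proof. by rewrite !enorm_sqr -opprB dotvNl dotvNr opprK. Qed.

Lemma enorm_sqrZ a u : enorm (a *: u) ^+ 2 = a ^+ 2 * enorm u ^+ 2.
Proof. by rewrite !enorm_sqr !dotv_linE mulrA -expr2. Qed.

Lemma enorm_sqr_le2 u v :
  enorm (u + v) ^+ 2 <= 2 * enorm u ^+ 2 + 2 * enorm v ^+ 2.
Proof. by rewrite enorm_sqrD; have := dotv_le_half u v; lra. Qed.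

(** Cauchy-Schwarz against the constant 1: the square expands into pairwise inner products, each at
    most the mean of two squared norms. *)
Lemma enorm_sqr_sum_le (I : finType) (Q : pred I) (F : I -> 'rV[R]_d) :
  enorm (\sum_(i | Q i) F i) ^+ 2
    <= (\sum_(i | Q i) 1) * \sum_(i | Q i) enorm (F i) ^+ 2.
Proof.
rewrite enorm_sqr dotv_suml.
apply: (@le_trans _ _
  (\sum_(i | Q i) \sum_(j | Q j) (enorm (F i) ^+ 2 + enorm (F j) ^+ 2) / 2)).
  apply: ler_sum => i _; rewrite dotv_sumr; apply: ler_sum => j _.
  exact: dotv_le_half.
set N := \sum_(i | Q i) 1; set S := \sum_(i | Q i) _ ^+ 2.
have inner i : \sum_(j | Q j) (enorm (F i) ^+ 2 + enorm (F j) ^+ 2) / 2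
    = (enorm (F i) ^+ 2 * N + 1 * S) / 2.
  rewrite -mulr_suml big_split/= mul1r mulr_sumr.
  by under [in RHS]eq_bigr do rewrite mulr1.
under eq_bigr do rewrite inner.
by rewrite -mulr_suml big_split/= -!mulr_suml -/N -/S; lra.
Qed.

End Euclidean.

(** * Gradients and the descent lemma *)

Section Descent.
Context {R : realType} {d : nat}.
Implicit Types (g : 'rV[R]_d -> R) (x v : 'rV[R]_d).

Lemma derive_grad g x v :
  differentiable (g : 'rV[R]_d -> R^o) x ->
  'D_v (g : 'rV[R]_d -> R^o) x = dotv (grad g x) v.
Proof.
move=> gx; rewrite deriveE// [in LHS](row_sum_delta v) linear_sum dotvE.
apply: eq_bigr => j _; rewrite linearZ/= mxE deriveE//.
by rewrite mulrC.
Qed.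

Lemma is_derive_line g x v (t : R) :
  (forall y, differentiable (g : 'rV[R]_d -> R^o) y) ->
  is_derive t 1 (fun s : R => g (x + s *: v) : R^o)
    (dotv (grad g (x + t *: v)) v).
Proof.
move=> gd; rewrite -derive_grad//.
have ld : is_diff t (fun s : R => x + s *: v) (fun s : R => s *: v).
  have := is_diffD (is_diff_cst x t) (is_diff_scalel t v).
  by rewrite add0r.
have gcd : differentiable (fun s : R => g (x + s *: v) : R^o) t.
  by apply: (@differentiable_comp _ _ _ _ (fun s : R => x + s *: v)
    (g : _ -> R^o)).
apply: DeriveDef.
  exact/derivable1_diffP.
rewrite deriveE// deriveE//.
rewrite (diff_comp (f := fun s : R => x + s *: v) (g := (g : _ -> R^o)))//=.
by rewrite diff_val scale1r.
Qed.

Lemma smooth_descent (L : R) g x v : 0 < L -> smooth L g ->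
  g (x + v) <= g x + dotv (grad g x) v + L / 2 * enorm v ^+ 2.
Proof.
move=> L0 [gd gL].
pose h (t : R) : R^o := g (x + t *: v) - t * dotv (grad g x) v
   - L / 2 * enorm v ^+ 2 * t ^+ 2.
have hd (t : R) : is_derive t (1 : R) h (dotv (grad g (x + t *: v)) v
    - dotv (grad g x) v - L * enorm v ^+ 2 * t).
  have := @is_derive_line g x v t gd => D.
  rewrite /h; apply: is_derive_eq. 
  by rewrite /GRing.scale/=; field.
have hc : {within `[(0 : R), 1], continuous h}.
  apply: continuous_subspaceT => t.
  by apply/differentiable_continuous/derivable1_diffP; case: (hd t).
have [c] := MVT ltr01 (fun t _ => hd t) hc.
rewrite in_itv/= => /andP[c0 c1].
rewrite /h !scale0r !scale1r !addr0 subr0 !mul0r !mul1r expr0n expr1n/=.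
set w := grad g (x + c *: v); set w0 := grad g x.
have wL : enorm (w - w0) ^+ 2 <= (L * c) ^+ 2 * enorm v ^+ 2.
  rewrite exprMn -mulrA -enorm_sqrZ -exprMn lerXn2r ?nnegrE ?enorm_ge0//.
    by rewrite mulr_ge0 ?enorm_ge0// ltW.
  by rewrite (le_trans (gL _ _))// addrAC subrr add0r.
have Lc0 : 0 < L * c by rewrite mulr_gt0.
(* Young's inequality with weight [(L * c)^-1]: by the Lipschitz bound the rescaled vector has norm
   at most that of [v], so both squares are bounded by the same quantity. *)
have := dotv_le_half ((L * c)^-1 *: (w - w0)) v.
rewrite enorm_sqrZ dotvZl -(ler_pM2l Lc0) mulrA divff ?gt_eqF// mul1r.
rewrite dotvDl dotvNl => le1 eq1.
have le2 : (L * c)^-1 ^+ 2 * enorm (w - w0) ^+ 2 <= enorm v ^+ 2.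
  by rewrite exprVn mulrC ler_pdivrMr ?exprn_gt0// mulrC.
have : dotv w v - dotv w0 v <= L * c * enorm v ^+ 2.
  by apply: (le_trans le1); rewrite ler_wpM2l ?(ltW Lc0)//; lra.
by move: eq1; rewrite mulr0 !mulr1 subr0 -mulrA (mulrC _ c) mulrA; lra.
Qed.

End Descent.

(** * Sampling without replacement, as sums over all permutations *)

Section RandomPermutation.
Context {R : realType} {d n : nat}.
Implicit Types (i j k : 'I_n) (s : 'S_n).

Lemma sum_perm_tperm (V : zmodType) (F : 'I_n -> 'I_n -> V) i j k :
  \sum_(s : 'S_n) F (s i) (s j)
    = \sum_(s : 'S_n) F (s (tperm k j i)) (s (tperm k j j)).
Proof.
rewrite (reindex_inj (mulgI (tperm k j))).
by apply: eq_bigr => s _; rewrite !permM.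
Qed.

(** Every position of a uniform permutation is uniform: transpositions show that the left sum does
    not depend on [i], and summing it over all positions gives the full sum once for each
    permutation. Multiples replace means to avoid division. *)
Lemma sum_perm_elt (V : zmodType) (F : 'I_n -> V) i :
  (\sum_(s : 'S_n) F (s i)) *+ n = (\sum_j F j) *+ n`!.
Proof.
transitivity (\sum_j \sum_(s : 'S_n) F (s j)).
  transitivity (\sum_(j < n) \sum_(s : 'S_n) F (s i)).
    by rewrite sumr_const card_ord.
  apply: eq_bigr => j _.
  by rewrite (sum_perm_tperm (fun _ => F) i i j) tpermR.
rewrite exchange_big/=.
under eq_bigr => s _.
  have -> : \sum_j F (s j) = \sum_j F j.
    by rewrite [RHS](reindex_inj (h := s) perm_inj).
  over.
rewrite sumr_const; congr (_ *+ _).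
by rewrite card_Sn.
Qed.

(** Negative correlation of distinct draws. By transpositions all [j != i] give the same value.
    Since each permuted family sums to 0, these [n.-1] equal values add up to minus a sum of
    squares. *)
Lemma sum_perm_dotv_le0 (Y : 'I_n -> 'rV[R]_d) i j :
  \sum_k Y k = 0 -> i != j ->
  \sum_(s : 'S_n) dotv (Y (s i)) (Y (s j)) <= 0.
Proof.
move=> Y0 ij.
have eqj k : i != k -> \sum_(s : 'S_n) dotv (Y (s i)) (Y (s k))
    = \sum_(s : 'S_n) dotv (Y (s i)) (Y (s j)).
  move=> ik; rewrite (sum_perm_tperm (fun a b => dotv (Y a) (Y b)) i j k).
  by rewrite tpermR tpermD// eq_sym.
have : (\sum_(s : 'S_n) dotv (Y (s i)) (Y (s j))) *+ n.-1
    = - \sum_(s : 'S_n) dotv (Y (s i)) (Y (s i)).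
  transitivity (\sum_(k | k != i) \sum_(s : 'S_n) dotv (Y (s i)) (Y (s k))).
    under [in RHS]eq_bigr => k ki do rewrite eqj 1?eq_sym//.
    rewrite sumr_const; congr (_ *+ _).
    by have := cardC1 i; rewrite card_ord => <-; apply: eq_card.
  rewrite exchange_big/= -sumrN; apply: eq_bigr => s _.
  have Ys0 : \sum_k Y (s k) = 0.
    by rewrite -[RHS]Y0 [RHS](reindex_inj (h := s) perm_inj).
  have : dotv (Y (s i)) (\sum_k Y (s k)) = 0 by rewrite Ys0 dotvC dotv0l.
  by rewrite dotv_sumr (bigD1 i)//= addrC => /eqP; rewrite addr_eq0 => /eqP.
move=> e; have n1 : (0 < n.-1)%N.
  have := ltn_ord i; have := ltn_ord j; move: ij; rewrite -val_eqE/=; lia.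
rewrite -(pmulrn_lle0 _ n1) e oppr_le0 sumr_ge0// => s _; exact: dotvv_ge0.
Qed.

(** In the expanded square the off-diagonal pairs contribute at most 0 and each diagonal one
    contributes the mean of the squared norms, so the variance is at most that of independent
    draws. *)
Lemma sum_perm_centered_enorm_sqr_le (Y : 'I_n -> 'rV[R]_d) (Q : pred 'I_n) :
  \sum_k Y k = 0 ->
  \sum_(s : 'S_n) enorm (\sum_(i | Q i) Y (s i)) ^+ 2
    <= n`!%:R * ((\sum_(i | Q i) 1) * (n%:R^-1 * \sum_k enorm (Y k) ^+ 2)).
Proof.
move=> Y0.
have -> : \sum_(s : 'S_n) enorm (\sum_(i | Q i) Y (s i)) ^+ 2
    = \sum_(i | Q i) \sum_(j | Q j) \sum_(s : 'S_n) dotv (Y (s i)) (Y (s j)).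
  under eq_bigr do rewrite enorm_sqr dotv_suml.
  rewrite exchange_big/=; apply: eq_bigr => i _.
  under eq_bigr do rewrite dotv_sumr.
  by rewrite exchange_big.
rewrite mulrCA mulr_suml; apply: ler_sum => i Qi; rewrite mul1r.
rewrite (bigD1 i)//= -[leRHS]addr0 lerD//; last first.
  apply: sumr_le0 => j /andP[_ ji].
  by apply: sum_perm_dotv_le0; rewrite // eq_sym.
have n0 : n%:R != 0 :> R by rewrite pnatr_eq0 -lt0n (leq_trans _ (ltn_ord i)).
have := sum_perm_elt (fun k => enorm (Y k) ^+ 2) i.
rewrite -[LHS]mulr_natl -[RHS]mulr_natl => e.
rewrite mulrCA -e mulKf//; apply: ler_sum => s _; by rewrite enorm_sqr.
Qed.

(** Bias-variance decomposition: after centering at the mean [m], the cross term vanishes because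
    every centered draw sums to 0 over the permutations. *)
Lemma sum_perm_enorm_sqr_le (X : 'I_n -> 'rV[R]_d) (m : 'rV[R]_d)
    (Q : pred 'I_n) : \sum_k X k = n%:R *: m ->
  \sum_(s : 'S_n) enorm (\sum_(i | Q i) X (s i)) ^+ 2
    <= n`!%:R * ((\sum_(i | Q i) 1) ^+ 2 * enorm m ^+ 2 +
         (\sum_(i | Q i) 1) * (n%:R^-1 * \sum_k enorm (X k - m) ^+ 2)).
Proof.
move=> Xm; set N := \sum_(i | Q i) 1.
have Y0 : \sum_k (X k - m) = 0.
  by rewrite sumrB Xm sumr_const card_ord scaler_nat subrr.
have -> : \sum_(s : 'S_n) enorm (\sum_(i | Q i) X (s i)) ^+ 2 =
    \sum_(s : 'S_n) (enorm (N *: m) ^+ 2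
      + 2 * dotv (N *: m) (\sum_(i | Q i) (X (s i) - m))
      + enorm (\sum_(i | Q i) (X (s i) - m)) ^+ 2).
  apply: eq_bigr => s _; rewrite -enorm_sqrD; congr (enorm _ ^+ 2).
  rewrite sumrB scaler_suml; under [in RHS]eq_bigr do rewrite scale1r.
  by rewrite subrKC.
have cross :
    \sum_(s : 'S_n) 2 * dotv (N *: m) (\sum_(i | Q i) (X (s i) - m)) = 0.
  rewrite -mulr_sumr -dotv_sumr exchange_big/= big1 => [|i _].
    by rewrite dotvC dotv0l mulr0.
  have := sum_perm_elt (fun k => X k - m) i; rewrite Y0 mul0rn => /eqP.
  rewrite -(scaler_nat (R := R)) scaler_eq0 pnatr_eq0 => /orP[/eqP n0|/eqP//].
  by have := ltn_ord i; rewrite [X in (_ < X)%N]n0.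
rewrite 2!big_split/= cross addr0 sumr_const card_Sn mulrDr lerD//.
  by rewrite enorm_sqrZ mulr_natl.
exact: sum_perm_centered_enorm_sqr_le.
Qed.

End RandomPermutation.

(** * Bounds for sums of indices and of their squares *)

Section OrdinalSums.
Context {R : realType}.

Lemma sum1_ord_lt (n k : nat) : (k <= n)%N ->
  \sum_(i < n | (i < k)%N) 1 = k%:R :> R.
Proof.
move=> kn; rewrite -(big_ord_widen n (fun=> 1) kn).
by rewrite sumr_const card_ord.
Qed.

Lemma sum_ord_le (n : nat) : \sum_(k < n) k%:R <= n%:R ^+ 2 / 2 :> R.
Proof.
elim: n => [|n IH]; first by rewrite big_ord0 expr0n/= mul0r.
by rewrite big_ord_recr/= -natr1; lra.
Qed.

Lemma sum_ord_sqr_le (n : nat) : \sum_(k < n) k%:R ^+ 2 <= n%:R ^+ 3 / 3 :> R.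
Proof.
elim: n => [|n IH]; first by rewrite big_ord0 expr0n/= mul0r.
rewrite big_ord_recr/= -natr1; have := ler0n R n; nra.
Qed.

End OrdinalSums.

(** * Analysis of one epoch *)

Section Epoch.
Context {R : realType} {d n : nat}.
Variables (f : 'I_n -> 'rV[R]_d -> R) (L gamma : R).
Hypotheses (n_gt0 : (0 < n)%N) (L_gt0 : 0 < L) (gamma_gt0 : 0 < gamma).
Hypotheses (f_smooth : forall i, smooth L (f i)).
Hypotheses (favg_smooth : smooth L (favg f)).
Hypothesis gamma_le : 2 * gamma * L * n%:R <= 1.

Let nR_gt0 : 0 < n%:R :> R. Proof. by rewrite ltr0n. Qed.

Let gammaLn_sqr_le : (gamma * L * n%:R) ^+ 2 <= 1 / 4.
Proof.
have y0 : 0 <= gamma * L * n%:R by rewrite !mulr_ge0// ltW.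
have y1 : gamma * L * n%:R <= 1 / 2 by move: gamma_le; lra.
by rewrite (le_trans (lerXn2r 2 _ _ y1)) ?nnegrE//; lra.
Qed.

Lemma sum_grad_favg x : \sum_i grad (f i) x = n%:R *: grad (favg f) x.
Proof.
apply/rowP => j; rewrite summxE !mxE.
have -> : (favg f : _ -> R^o) = n%:R^-1 *: (\sum_(i < n) f i : 'rV[R]_d -> R^o).
  by apply/funext => y; rewrite /favg fct_sumE.
have fd i : derivable (f i : _ -> R^o) x (delta_mx ord0 j).
  by apply: diff_derivable; case: (f_smooth i).
rewrite deriveZ; last exact: derivable_sum.
rewrite derive_sum// [RHS]mulrA mulfV ?gt_eqF// mul1r.
by apply: eq_bigr => i _; rewrite mxE.
Qed.

Definition rr_inner (s : 'S_n) (x : 'rV[R]_d) (k : nat) :=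
  foldl (fun y i => y - gamma *: grad (f (s i)) y) x (take k (enum 'I_n)).

Lemma rr_inner_epoch s x : rr_inner s x n = rr_epoch f gamma s x.
Proof. by rewrite /rr_inner take_oversize// size_enum_ord. Qed.

Lemma rr_innerE s x k : (k <= n)%N ->
  rr_inner s x k =
    x - gamma *: \sum_(i < n | (i < k)%N) grad (f (s i)) (rr_inner s x i).
Proof.
elim: k => [_|k IH kn].
  by rewrite big_pred0// scaler0 subr0 /rr_inner take0.
pose i0 := Ordinal kn.
have -> : rr_inner s x k.+1 =
    rr_inner s x k - gamma *: grad (f (s i0)) (rr_inner s x k).
  rewrite /rr_inner (take_nth i0) ?size_enum_ord// foldl_rcons.
  by rewrite (nth_ord_enum i0 i0).
rewrite {1}IH 1?ltnW// [in RHS](bigD1 i0)//= scalerDr opprD addrA addrAC.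
congr (_ - _ *: _ - _).
by apply: eq_bigl => i; rewrite -val_eqE/=; lia.
Qed.

Definition rr_drift (s : 'S_n) (x : 'rV[R]_d) : R :=
  \sum_(k < n) enorm (rr_inner s x k - x) ^+ 2.

Lemma rr_drift_ge0 s x : 0 <= rr_drift s x.
Proof. by apply: sumr_ge0 => k _; exact: sqr_ge0. Qed.

Lemma smooth_grad_sub_sqr_le g (x y : 'rV[R]_d) : smooth L g ->
  enorm (grad g x - grad g y) ^+ 2 <= L ^+ 2 * enorm (x - y) ^+ 2.
Proof.
case=> _ gL; rewrite -exprMn lerXn2r ?nnegrE ?enorm_ge0//.
by rewrite mulr_ge0 ?enorm_ge0// ltW.
Qed.

(** Each displacement is a sum of gradients at inner iterates. Replacing them by gradients at [x]
    costs, by smoothness, at most [L ^+ 2 * V * k] in squared norm, where [V] is the whole drift.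
    Summed over [k] this puts [(gamma * L * n%:R) ^+ 2 * V], at most a quarter of [V], on the right,
    and it is absorbed on the left. *)
Lemma rr_drift_le s x :
  3 / 4 * rr_drift s x <= 2 * gamma ^+ 2 *
    \sum_(k < n) enorm (\sum_(i < n | (i < k)%N) grad (f (s i)) x) ^+ 2.
Proof.
set V := rr_drift s x.
have step (k : 'I_n) : enorm (rr_inner s x k - x) ^+ 2 <=
    2 * gamma ^+ 2 * L ^+ 2 * V * k%:R + 2 * gamma ^+ 2 *
      enorm (\sum_(i < n | (i < k)%N) grad (f (s i)) x) ^+ 2.
  rewrite rr_innerE 1?ltnW// addrAC subrr add0r -scaleNr enorm_sqrZ sqrrN.
  set S := \sum_(i < n | (i < k)%N) grad _ x.
  set D := \sum_(i < n | (i < k)%N)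
     (grad (f (s i)) (rr_inner s x i) - grad (f (s i)) x).
  have -> : \sum_(i < n | (i < k)%N) grad (f (s i)) (rr_inner s x i) = D + S.
    by rewrite /D sumrB subrK.
  have leD : enorm D ^+ 2 <= L ^+ 2 * V * k%:R.
    rewrite (le_trans (enorm_sqr_sum_le _ _))// sum1_ord_lt 1?ltnW//.
    rewrite mulrC ler_wpM2r ?ler0n// /V /rr_drift mulr_sumr.
    rewrite [leRHS](bigID (fun i : 'I_n => (i < k)%N))/= -[leLHS]addr0 lerD//.
      by apply: ler_sum => i _; apply: smooth_grad_sub_sqr_le.
    by apply: sumr_ge0 => i _; rewrite mulr_ge0 ?sqr_ge0.
  have := enorm_sqr_le2 D S; have := sqr_ge0 gamma; nra.
have : V <= gamma ^+ 2 * L ^+ 2 * V * n%:R ^+ 2 + 2 * gamma ^+ 2 *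
    \sum_(k < n) enorm (\sum_(i < n | (i < k)%N) grad (f (s i)) x) ^+ 2.
  rewrite {1}/V; apply: le_trans (ler_sum _ (fun k _ => step k)) _.
  rewrite big_split/= -!mulr_sumr lerD2r.
  have := sum_ord_le n (R := R); have := rr_drift_ge0 s x; rewrite -/V => V0.
  have c0 : 0 <= 2 * gamma ^+ 2 * L ^+ 2 * V.
    by apply: mulr_ge0 => //; rewrite -mulrA -exprMn mulr_ge0 ?sqr_ge0.
  by move=> /(ler_wpM2l c0); lra.
have := ler_wpM2r (rr_drift_ge0 s x) gammaLn_sqr_le.
by rewrite -/V !exprMn; lra.
Qed.

(** An epoch is a single step of length [gamma * n%:R] along the mean [g] of the gradients used. The
    descent lemma applies to it, and polarization turns the inner product of [G] and [g] into
    squared norms, the error [G - g] being controlled by the drift. *)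
Lemma rr_epoch_descent s x :
  favg f (rr_epoch f gamma s x) <= favg f x
    - gamma * n%:R / 2 * enorm (grad (favg f) x) ^+ 2
    + gamma * L ^+ 2 / 2 * rr_drift s x.
Proof.
set G := grad (favg f) x.
pose g := n%:R^-1 *: \sum_(i < n) grad (f (s i)) (rr_inner s x i).
have ->  : rr_epoch f gamma s x = x + (- (gamma * n%:R)) *: g.
  rewrite -rr_inner_epoch rr_innerE// scaleNr scalerA mulfK ?gt_eqF//.
  by congr (_ - _ *: _); apply: eq_bigl => i; rewrite ltn_ord.
apply: le_trans (smooth_descent _ _ L_gt0 favg_smooth) _.
rewrite enorm_sqrZ dotvZr -/G.
have gG : enorm (G - g) ^+ 2 <= n%:R^-1 * L ^+ 2 * rr_drift s x.
  have -> : G - g = n%:R^-1 *: \sum_(i < n)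
      (grad (f (s i)) x - grad (f (s i)) (rr_inner s x i)).
    rewrite sumrB scalerBr; congr (_ - _).
    have -> : \sum_(i < n) grad (f (s i)) x = \sum_i grad (f i) x.
      by rewrite [RHS](reindex_inj (h := s) perm_inj).
    by rewrite sum_grad_favg scalerA mulVf ?gt_eqF// scale1r.
  rewrite enorm_sqrZ expr2 -!mulrA ler_wpM2l ?invr_ge0 ?ler0n//.
  rewrite mulrC ler_pdivrMr// mulrC.
  rewrite (le_trans (enorm_sqr_sum_le _ _))// sumr_const card_ord.
  rewrite ler_wpM2l ?ler0n//.
  rewrite mulrA -expr2 /rr_drift mulr_sumr; apply: ler_sum => i _.
  by rewrite [in leRHS]enorm_sqrBC smooth_grad_sub_sqr_le.
have : gamma * n%:R * enorm (G - g) ^+ 2 <= gamma * L ^+ 2 * rr_drift s x.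
  have gn0 : 0 <= gamma * n%:R by rewrite mulr_ge0// ltW.
  by apply: le_trans (ler_wpM2l gn0 gG) _; rewrite -!mulrA mulVKf ?gt_eqF.
(* Up to a factor 1/2, this is what polarization and the quadratic term of the descent lemma leave
   in front of the squared norm of [g]; the stepsize bound lets it be dropped. *)
have : gamma * n%:R * (1 - gamma * L * n%:R) * enorm g ^+ 2 >= 0.
  apply: mulr_ge0; rewrite ?sqr_ge0 ?mulr_ge0 ?(ltW nR_gt0) ?(ltW gamma_gt0)//.
  by move: gamma_le; lra.
rewrite enorm_sqrB sqrrN; lra.
Qed.

(** The drift enters with total factor 4/3 [gamma ^+ 3 * L ^+ 2]. Its gradient part, with
    [n%:R ^+ 3 / 3], costs at most 4/9 * 1/4 = 1/9 of [gamma * n%:R], and 1/2 - 1/9 = 7/18; its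
    variance part, with [n%:R ^+ 2 / 2], gives 2/3. *)
Lemma rr_epoch_avg_le (x : 'rV[R]_d) (sigma : R) :
  n%:R^-1 * \sum_(i < n) enorm (grad (f i) x - grad (favg f) x) ^+ 2 <= sigma ->
  n`!%:R^-1 * (\sum_(s : 'S_n) favg f (rr_epoch f gamma s x)) <= favg f x
    - 7 / 18 * gamma * n%:R * enorm (grad (favg f) x) ^+ 2
    + 2 / 3 * gamma ^+ 3 * L ^+ 2 * n%:R ^+ 2 * sigma.
Proof.
move=> le_sigma; set G := enorm _ ^+ 2.
have N0 : 0 < n`!%:R :> R by rewrite ltr0n fact_gt0.
have nR0 := nR_gt0.
pose W := \sum_(k < n) \sum_(s : 'S_n)
  enorm (\sum_(i < n | (i < k)%N) grad (f (s i)) x) ^+ 2.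
have W_le : W <= n`!%:R * (n%:R ^+ 3 / 3 * G + n%:R ^+ 2 / 2 * sigma).
  apply: (@le_trans _ _ (\sum_(k < n) n`!%:R * (k%:R ^+ 2 * G + k%:R * sigma))).
    apply: ler_sum => k _.
    apply: le_trans (sum_perm_enorm_sqr_le _ (sum_grad_favg x)) _.
    rewrite sum1_ord_lt 1?ltnW// ler_wpM2l ?ler0n// lerD2l.
    by rewrite ler_wpM2l ?ler0n.
  rewrite -mulr_sumr ler_wpM2l ?ler0n// big_split/= -!mulr_suml lerD//.
    by rewrite ler_wpM2r ?sqr_ge0 ?sum_ord_sqr_le.
  rewrite ler_wpM2r ?sum_ord_le// (le_trans _ le_sigma)//.
  by rewrite mulr_ge0 ?invr_ge0 ?ler0n// sumr_ge0// => i _; rewrite sqr_ge0.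
have drift_le : 3 / 4 * (\sum_(s : 'S_n) rr_drift s x) <= 2 * gamma ^+ 2 * W.
  rewrite /W [in leRHS]exchange_big/= mulr_sumr [leRHS]mulr_sumr.
  apply: ler_sum => s _.
  exact: rr_drift_le.
have sum_le : \sum_(s : 'S_n) favg f (rr_epoch f gamma s x) <= n`!%:R *
    (favg f x - gamma * n%:R / 2 * G)
    + gamma * L ^+ 2 / 2 * \sum_(s : 'S_n) rr_drift s x.
  apply: le_trans (ler_sum _ (fun s _ => rr_epoch_descent s x)) _.
  by rewrite big_split/= sumr_const card_Sn -mulr_sumr mulr_natl.
have gG : gamma ^+ 3 * L ^+ 2 * n%:R ^+ 3 * G <= gamma * n%:R * G / 4.
  have gnG : 0 <= gamma * n%:R * G.
    by rewrite mulr_ge0 ?sqr_ge0// mulr_ge0// ltW.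
  have := ler_wpM2l gnG gammaLn_sqr_le; rewrite !exprMn; lra.
rewrite mulrC ler_pdivrMr//.
set D := \sum_s rr_drift s x in drift_le sum_le.
have gL0 : 0 <= gamma * L ^+ 2 / 2 * (4 / 3).
  by rewrite mulr_ge0// mulr_ge0// mulr_ge0 ?sqr_ge0// ltW.
have h1 := ler_wpM2l gL0 drift_le.
have gL1 : 0 <= gamma * L ^+ 2 / 2 * (4 / 3) * (2 * gamma ^+ 2).
  by rewrite mulr_ge0// mulr_ge0 ?sqr_ge0.
have h2 := ler_wpM2l gL1 W_le.
have h3 := ler_wpM2l (ltW N0) gG.
lra.
Qed.

End Epoch.

(** * Two scalar recursions *)

Section Recursions.
Context {R : realType}.

(** The power is at most exp (4/3), the eighth power of exp (1/6). As exp (-1/6) >= 5/6, this is at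
    most (6/5)^8 < 14/3. The value 14/3 = 12 * 7/18 is what the factor 12 of the theorem allows. *)
Lemma expr1D_le (a : R) (T : nat) :
  0 <= a -> a * T%:R <= 4 / 3 -> (1 + a) ^+ T <= 14 / 3.
Proof.
move=> a0 aT; apply: (@le_trans _ _ (expR (8%:R * (1 / 6) : R))); last first.
  have e6 : expR (1 / 6 : R) <= 6 / 5.
    have := expR_ge1Dx (- (1 / 6) : R); rewrite expRN => h.
    rewrite -[leLHS]invrK -[leRHS]invrK.
    by rewrite lef_pV2 ?posrE ?invr_gt0 ?expR_gt0//; lra.
  rewrite mulrC expRM_natr (le_trans (lerXn2r 8 _ _ e6)) ?nnegrE ?expR_ge0//; lra.
apply: (@le_trans _ _ (expR a ^+ T)).
  by rewrite lerXn2r ?nnegrE ?expR_ge0 ?addr_ge0 ?expR_ge1Dx.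
by rewrite -expRM_natr ler_expR; lra.
Qed.

(** If every [b * G t] exceeded [e + c], each step would lose [e] besides the growth by [1 + a];
    after [T] steps the total loss is [14 / 3 * delta 0], which makes [delta T] negative. *)
Lemma recursion_min_le (delta G : nat -> R) (a b c : R) (T : nat) :
  (0 < T)%N -> 0 <= a -> a * T%:R <= 4 / 3 ->
  (forall t, (t <= T)%N -> 0 <= delta t) ->
  (forall t, (t < T)%N -> delta t.+1 <= (1 + a) * delta t - b * G t + c) ->
  exists2 t, (t < T)%N & b * G t <= 14 / 3 * delta 0%N / T%:R + c.
Proof.
move=> T0 a0 aT delta0 rec.
have TR0 : 0 < T%:R :> R by rewrite ltr0n.
set e := 14 / 3 * delta 0%N / T%:R.
have e0 : 0 <= e.
  have := delta0 0%N isT => d0; apply: divr_ge0 (ler0n _ _).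
  by apply: mulr_ge0 => //; lra.
apply: contrapT => /forall2NP noG.
have big t : (t < T)%N -> e + c < b * G t.
  by move=> tT; case: (noG t) => // /negP; rewrite -ltNge.
have le t : (t < T)%N -> delta t <= (1 + a) ^+ t * delta 0%N - e * t%:R.
  elim: t => [|t IH] tT; first by rewrite expr0 mulr0 subr0 mul1r.
  have := IH (ltnW tT); have := rec t (ltnW tT); have := big t (ltnW tT).
  move=> h1 h2 /(ler_wpM2l (addr_ge0 ler01 a0)).
  rewrite exprS -natr1.
  have := mulr_ge0 a0 (mulr_ge0 e0 (ler0n R t)).
  lra.
(* The induction gives only a weak inequality, up to the last index below [T]; the final step is
   done by hand to keep the strictness needed for the contradiction. *)
case: T T0 aT delta0 rec TR0 @e e0 noG big le => //.
move=> T _ aT delta0 rec TR0 e e0 _ big le.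
have := le T (ltnSn T) => /(ler_wpM2l (addr_ge0 ler01 a0)).
have := rec T (ltnSn T); have := big T (ltnSn T); have := delta0 T.+1 (leqnn _).
have := mulr_ge0 a0 (mulr_ge0 e0 (ler0n R T)).
have : (1 + a) ^+ T.+1 * delta 0%N <= 14 / 3 * delta 0%N.
  by rewrite ler_wpM2r ?delta0 ?expr1D_le.
have : e * T.+1%:R = 14 / 3 * delta 0%N by rewrite /e mulfVK ?gt_eqF.
by rewrite exprS -natr1; lra.
Qed.

(** The affine map with slope [q] and constant [c] sends [N] to at most [N], so adding [N] to the
    geometric bound absorbs the constant at every step. The slower rate [r] only weakens the
    bound. *)
Lemma recursion_contract_le (delta : nat -> R) (q r c N : R) (T : nat) :
  0 <= q -> q <= r -> 0 <= delta 0%N -> q * N + c <= N ->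
  0 <= N ->
  (forall t, (t < T)%N -> delta t.+1 <= q * delta t + c) ->
  forall t, (t <= T)%N -> delta t <= r ^+ t * delta 0%N + N.
Proof.
move=> q0 qr d0 qN N0 rec; elim=> [|t IH] tT.
  by rewrite expr0 mul1r lerDl.
have := ler_wpM2l q0 (IH (ltnW tT)); have := rec t tT.
have : q * (r ^+ t * delta 0%N) <= r * (r ^+ t * delta 0%N).
  by rewrite ler_wpM2r// mulr_ge0// exprn_ge0// (le_trans q0).
by rewrite exprS; lra.
Qed.

End Recursions.

(** * Expectations of functions of finitely many permutations *)

Section FiniteExpectation.
Context (disp : measure_display) (Omega : measurableType disp) (R : realType)
  (P : probability Omega R).

(** The integrand is a finite combination of indicators of the fibers of [X]; nonnegativity lets the
    integral pass through the sum without an integrability argument. *)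
Lemma expectation_finite (S : finType) (X : Omega -> S) (F : S -> R) :
  (forall s, measurable (X @^-1` [set s])) -> (forall s, 0 <= F s) ->
  ('E_P[fun w => F (X w)] = \sum_s (F s)%:E * P (X @^-1` [set s]))%E.
Proof.
move=> mX F0; rewrite unlock.
under eq_integral => w _.
  have -> : F (X w) = \sum_s F s * \1_(X @^-1` [set s]) w.
    rewrite (bigD1 (X w))//= big1 ?addr0 => [|s sX].
      by rewrite indicE mem_set// mulr1.
    by rewrite indicE memNset ?mulr0// => /= /eqP; rewrite eq_sym (negbTE sX).
  rewrite -sumEFin; over.
rewrite ge0_integral_sum//; last first.
- by move=> s w _; rewrite lee_fin mulr_ge0.
- move=> s; apply/measurable_EFinP; apply: measurable_funM => //.
apply: eq_bigr => s _.
rewrite (integralZl_indic measurableT (fun=> X @^-1` [set s]))//.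
  by rewrite integral_indic ?setIT.
by move=> s0; have := F0 s; rewrite leNgt s0.
Qed.

Section UniformPerms.
Variables (n T : nat) (p : nat -> Omega -> 'S_n).
Hypothesis p_unif : independent_uniform_perms P T p.

(** The first [T] permutations are bundled into one element of a finite type, on which independence
    makes the law uniform. *)
Definition perm_history (w : Omega) : {ffun 'I_T -> 'S_n} :=
  [ffun i : 'I_T => p i w].

Lemma perm_historyE (s : {ffun 'I_T -> 'S_n}) :
  perm_history @^-1` [set s] =
    \bigcap_(i in [set i | i \in [set: 'I_T]%SET]) p i @^-1` [set s i].
Proof.
apply/seteqP; split => w /=.
  by move=> <- i _; rewrite /= ffunE.
by move=> ws; apply/ffunP => i; rewrite ffunE; apply: ws; rewrite /= inE.
Qed.

Lemma measurable_perm_history s : measurable (perm_history @^-1` [set s]).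
Proof.
rewrite perm_historyE; apply: fin_bigcap_measurable => //.
by move=> i _; case: p_unif => + _ _; apply.
Qed.

Lemma perm_history_law s : P (perm_history @^-1` [set s]) = (n`!%:R^-1 ^+ T)%:E.
Proof.
case: p_unif => _ unif indep.
rewrite perm_historyE (indep [set: 'I_T]%SET (fun i => [set s i])).
under eq_bigr do rewrite unif.
rewrite prodEFin; congr _%:E.
by rewrite prodr_const cardsT card_ord.
Qed.

Lemma expectation_perm_history (F : {ffun 'I_T -> 'S_n} -> R) :
  (forall s, 0 <= F s) ->
  ('E_P[fun w => F (perm_history w)] = (n`!%:R^-1 ^+ T * \sum_s F s)%R%:E)%E.
Proof.
move=> F0; rewrite (expectation_finite measurable_perm_history F0).
under eq_bigr do rewrite perm_history_law -EFinM.
by rewrite sumEFin -mulr_suml mulrC.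
Qed.

End UniformPerms.
End FiniteExpectation.

(** A gradient step of length [L^-1] lowers [g] by half the squared gradient norm over [L], and
    cannot go below [fstar]. *)
Lemma smooth_grad_sqr_le (R : realType) (d : nat) (L fstar : R)
    (g : 'rV[R]_d -> R) (x : 'rV[R]_d) : 0 < L -> smooth L g ->
  (forall y, fstar <= g y) -> enorm (grad g x) ^+ 2 <= 2 * L * (g x - fstar).
Proof.
move=> L0 gL ge; have := smooth_descent x (- L^-1 *: grad g x) L0 gL.
have := ge (x + - L^-1 *: grad g x).
rewrite dotvZr -enorm_sqr enorm_sqrZ sqrrN => h1 h2.
have L2 : 0 <= 2 * L by rewrite mulr_ge0// ltW.
have := ler_wpM2l L2 (le_trans h1 h2).
set G := enorm _ ^+ 2.
have -> : 2 * L * (g x + - L^-1 * G + L / 2 * (L^-1 ^+ 2 * G)) =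
    2 * L * g x - G.
  by field; rewrite gt_eqF.
lra.
Qed.

(** * Averages over all histories of permutations *)

Section Mean.
Context {R : realType} {d n : nat}.
Variables (f : 'I_n -> 'rV[R]_d -> R) (gamma : R) (x0 : 'rV[R]_d) (T : nat).
Implicit Types (g h : 'rV[R]_d -> R) (s : {ffun 'I_T -> 'S_n}).

(** Beyond [T] the identity is a default value, which iterates up to time [T] never see. *)
Definition perm_seq s (t : nat) : 'S_n :=
  if insub t is Some i then s i else 1%g.

Lemma perm_seqE s (i : 'I_T) : perm_seq s i = s i.
Proof. by rewrite /perm_seq valK. Qed.

Lemma eq_rr_iter (s s' : nat -> 'S_n) (t : nat) :
  (forall u, (u < t)%N -> s u = s' u) ->
  rr_iter f gamma x0 s t = rr_iter f gamma x0 s' t.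
Proof.
elim: t => //= t IH ss'; rewrite ss' ?ltnSn// IH// => u ut.
by rewrite ss'// ltnS ltnW.
Qed.

(** The expectation of [g] at the [t]-th iterate as a finite sum; the histories keep length [T] for
    every [t], so all means live on one space and linearity is algebraic. *)
Definition rr_mean g (t : nat) : R :=
  n`!%:R^-1 ^+ T * \sum_s g (rr_iter f gamma x0 (perm_seq s) t).

Let w_ge0 : 0 <= n`!%:R^-1 ^+ T :> R.
Proof. by rewrite exprn_ge0 ?invr_ge0 ?ler0n. Qed.

Lemma rr_mean_le g h t : (forall x, g x <= h x) -> rr_mean g t <= rr_mean h t.
Proof. by move=> gh; rewrite ler_wpM2l// ler_sum. Qed.

Lemma rr_mean_ge0 g t : (forall x, 0 <= g x) -> 0 <= rr_mean g t.
Proof. by move=> g0; rewrite mulr_ge0// sumr_ge0. Qed.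

Lemma rr_meanD g h t :
  rr_mean (fun x => g x + h x) t = rr_mean g t + rr_mean h t.
Proof. by rewrite /rr_mean big_split/= mulrDr. Qed.

Lemma rr_meanZ c g t : rr_mean (fun x => c * g x) t = c * rr_mean g t.
Proof. by rewrite /rr_mean -mulr_sumr mulrCA. Qed.

Lemma rr_mean_cst c t : rr_mean (fun=> c) t = c.
Proof.
rewrite /rr_mean sumr_const card_ffun card_Sn card_ord -[c *+ _]mulr_natl natrX.
by rewrite mulrA -exprMn mulVf ?expr1n ?mul1r// pnatr_eq0 -lt0n fact_gt0.
Qed.

Lemma rr_mean0 g : rr_mean g 0 = g x0.
Proof. exact: (rr_mean_cst (g x0) 0). Qed.

(* The law of the permutations is invariant under left multiplication of the
   [t]-th one, which leaves the first [t] iterates unchanged. *)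
Lemma rr_mean_succ g t : (t < T)%N ->
  rr_mean g t.+1 =
    rr_mean (fun x => n`!%:R^-1 * \sum_(u : 'S_n) g (rr_epoch f gamma u x)) t.
Proof.
move=> tT; pose i0 := Ordinal tT.
pose shift (u : 'S_n) s := [ffun i => if i == i0 then (s i * u)%g else s i].
have shift_inj u : injective (shift u).
  move=> s s' /ffunP ss'; apply/ffunP => i; have := ss' i; rewrite !ffunE.
  by case: eqP => // _; apply: mulIg.
have shift_iter u s :
    rr_iter f gamma x0 (perm_seq (shift u s)) t
      = rr_iter f gamma x0 (perm_seq s) t.
  apply: eq_rr_iter => v vt; have vT := ltn_trans vt tT.
  rewrite (perm_seqE _ (Ordinal vT)) (perm_seqE _ (Ordinal vT)) ffunE.
  by rewrite -val_eqE/= ltn_eqF.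
have shift_sum u : \sum_s g (rr_iter f gamma x0 (perm_seq s) t.+1) =
    \sum_(s : {ffun 'I_T -> 'S_n}) g (rr_epoch f gamma (s i0 * u)%g
      (rr_iter f gamma x0 (perm_seq s) t)).
  rewrite (reindex_inj (shift_inj u)); apply: eq_bigr => s _ /=.
  by rewrite shift_iter (perm_seqE _ i0) ffunE eqxx.
rewrite /rr_mean; congr (_ * _); rewrite -mulr_sumr.
have N0 : n`!%:R != 0 :> R by rewrite pnatr_eq0 -lt0n fact_gt0.
(* Averaging the shifted sums over all [u] makes the permutation of epoch [t] independent of the
   history before it. *)
apply: (mulfI N0); rewrite mulVKf// mulr_natl -card_Sn -sumr_const.
under eq_bigr => u _ do rewrite (shift_sum u).
rewrite exchange_big/=; apply: eq_bigr => s _.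
by rewrite [RHS](reindex_inj (mulgI (s i0))).
Qed.

Lemma expectation_rr_iter (disp : measure_display)
    (Omega : measurableType disp) (P : probability Omega R)
    (p : nat -> Omega -> 'S_n) g t :
  independent_uniform_perms P T p -> (t <= T)%N -> (forall x, 0 <= g x) ->
  ('E_P[fun w => g (rr_iter f gamma x0 (fun u => p u w) t)]
    = (rr_mean g t)%:E)%E.
Proof.
move=> p_unif tT g0.
rewrite -(expectation_perm_history p_unif
  (F := fun s => g (rr_iter f gamma x0 (perm_seq s) t)))//.
congr expectation; apply/funext => w; congr g; apply: eq_rr_iter => u ut.
by rewrite (perm_seqE _ (Ordinal (leq_trans ut tT))) ffunE.
Qed.

End Mean.

(** * The stepsize condition and the two bounds *)

Lemma le_inv_cbrt (R : realType) (gamma z : R) : 0 < gamma -> 0 <= z ->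
  (gamma%:E <= ((z `^ 3^-1)%R%:E)^-1)%E -> gamma ^+ 3 * z <= 1.
Proof.
move=> g0 z0; rewrite inver powR_eq0.
(* For [z = 0] the inverse is [+oo] and the hypothesis carries no information, but the product is
   0. *)
have [-> _|zn0 /=] := eqVneq z 0; first by rewrite mulr0.
rewrite lee_fin => gz.
have y0 : 0 < z `^ 3^-1 by rewrite powR_gt0// lt_def zn0.
have gy : gamma * z `^ 3^-1 <= 1 by rewrite -ler_pdivlMr// div1r.
have -> : z = (z `^ 3^-1) ^+ 3.
  by rewrite -powR_mulrn ?powR_ge0// -powRrM mulVf ?pnatr_eq0// powRr1.
by rewrite -exprMn exprn_ile1// mulr_ge0// ltW.
Qed.

(* Inverses in the stepsize condition are taken in \bar R, where 0^-1 = +oo;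
   the second one is thus +oo when A = 0. *)
Theorem theorem4 (R : realType) (d n : nat) (f : 'I_n -> 'rV[R]_d -> R)
  (L fstar A B : R) (x0 : 'rV[R]_d) (T : nat) (gamma : R)
  (disp : measure_display) (Omega : measurableType disp)
  (P : probability Omega R) (p : nat -> Omega -> 'S_n)
  (n_gt0 : (0 < n)%N) (T_ge1 : (1 <= T)%N)
  (L_gt0 : 0 < L) (A_ge0 : 0 <= A) (B_ge0 : 0 <= B)
  (f_smooth : forall i, smooth L (f i))
  (favg_smooth : smooth L (favg f))
  (favg_ge : forall x, fstar <= favg f x)
  (variance_bound : forall x,
    n%:R^-1 * \sum_(i < n) enorm (grad (f i) x - grad (favg f) x) ^+ 2
      <= 2 * A * (favg f x - fstar) + B ^+ 2)
  (gamma_gt0 : 0 < gamma)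
  (gamma_le : (gamma%:E <=
    mine ((2 * L * n%:R)%R%:E^-1)
         (((A * L ^+ 2 * n%:R ^+ 2 * T%:R) `^ (3^-1))%R%:E^-1))%E)
  (p_unif : independent_uniform_perms P T p) :
  let x t (w : Omega) := rr_iter f gamma x0 (fun s => p s w) t in
  (\big[mine/+oo]_(t < T) 'E_P[fun w => (enorm (grad (favg f) (x t w)) ^+ 2)%R] <=
    (12 * (favg f x0 - fstar) / (gamma * n%:R * T%:R)
      + 2 * gamma ^+ 2 * L ^+ 2 * n%:R * B ^+ 2)%R%:E)%E
  /\
  (A = 0 -> forall mu : R, 0 < mu -> polyak_lojasiewicz mu fstar (favg f) ->
    let kappa := L / mu in
    ('E_P[fun w => (favg f (x T w) - fstar)%R] <=
      ((1 - gamma * mu * n%:R / 2) ^+ T * (favg f x0 - fstar)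
        + gamma ^+ 2 * kappa * L * n%:R * B ^+ 2)%R%:E)%E).
Proof.
move=> x.
have nR0 : 0 < n%:R :> R by rewrite ltr0n.
have TR0 : 0 < T%:R :> R by rewrite ltr0n.
have z0 : 0 <= A * L ^+ 2 * n%:R ^+ 2 * T%:R.
  by rewrite mulr_ge0 ?ler0n// mulr_ge0 ?sqr_ge0// mulr_ge0 ?sqr_ge0.
move: gamma_le; rewrite le_min => /andP[g1 /(le_inv_cbrt gamma_gt0 z0) g2].
have Ln0 : 0 < 2 * L * n%:R by rewrite !mulr_gt0.
have {}g1 : 2 * gamma * L * n%:R <= 1.
  move: g1; rewrite inver gt_eqF// lee_fin -[leRHS]div1r ler_pdivlMr//; lra.
pose delta y := favg f y - fstar.
pose G y := enorm (grad (favg f) y) ^+ 2.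
(* These are the constants of [rr_epoch_avg_le] with [sigma] equal to [2 * A * delta y + B ^+ 2];
   the part with [A] becomes the growth rate [a]. *)
pose a := 4 / 3 * gamma ^+ 3 * L ^+ 2 * n%:R ^+ 2 * A.
pose b := 7 / 18 * gamma * n%:R.
pose c := 2 / 3 * gamma ^+ 3 * L ^+ 2 * n%:R ^+ 2 * B ^+ 2.
have delta0 y : 0 <= delta y by rewrite subr_ge0.
have G0 y : 0 <= G y by exact: sqr_ge0.
pose M := rr_mean f gamma x0 T.
have rec t : (t < T)%N -> M delta t.+1 <= (1 + a) * M delta t - b * M G t + c.
  move=> tT; rewrite /M rr_mean_succ//.
  apply: (@le_trans _ _ (M (fun y => (1 + a) * delta y + - b * G y + c) t)).
    apply: rr_mean_le => y.
    have := rr_epoch_avg_le n_gt0 L_gt0 gamma_gt0 f_smooth favg_smooth g1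
      (variance_bound y).
    have fstarE : n`!%:R^-1 * (fstar *+ n`!) = fstar.
      by rewrite -[fstar *+ _]mulr_natl mulKf// pnatr_eq0 -lt0n fact_gt0.
    have -> : n`!%:R^-1 * (\sum_(u : 'S_n) delta (rr_epoch f gamma u y)) =
        n`!%:R^-1 * (\sum_(u : 'S_n) favg f (rr_epoch f gamma u y)) - fstar.
      by rewrite sumrB sumr_const card_Sn mulrBr fstarE.
    rewrite /a /b /c /G /delta; lra.
  rewrite /M (rr_meanD _ _ _ _ (fun y => (1 + a) * delta y + - b * G y)
    (fun=> c)).
  rewrite (rr_meanD _ _ _ _ (fun y => (1 + a) * delta y) (fun y => - b * G y)).
  by rewrite !rr_meanZ rr_mean_cst mulNr.
have M0 : M delta 0%N = delta x0 by exact: rr_mean0.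
have Mdelta0 t : 0 <= M delta t by exact: rr_mean_ge0.
have b0 : 0 < b by rewrite /b !mulr_gt0.
have c0 : 0 <= c.
  rewrite /c; apply: mulr_ge0 (sqr_ge0 _); apply: mulr_ge0 (sqr_ge0 _).
  by apply: mulr_ge0 (sqr_ge0 _); rewrite mulr_ge0// exprn_ge0// ltW.
split.
  have a0 : 0 <= a.
    rewrite /a; apply: mulr_ge0 => //; apply: mulr_ge0 (sqr_ge0 _).
    by apply: mulr_ge0 (sqr_ge0 _); rewrite mulr_ge0// exprn_ge0// ltW.
  have aT : a * T%:R <= 4 / 3 by rewrite /a; move: g2; lra.
  have [t tT bG] := recursion_min_le T_ge1 a0 aT (fun t _ => Mdelta0 t) rec.
  apply: (bigmin_inf (Ordinal tT)) => //=.
  rewrite (expectation_rr_iter _ _ _ p_unif (ltnW tT) G0) lee_fin -/M.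
  move: bG; rewrite M0 -/(delta x0) -ler_pdivlMl// => /le_trans; apply.
  (* Division by [b] turns 14/3 into 14/3 * 18/7 = 12. *)
  have -> : 12 * delta x0 / (gamma * n%:R * T%:R)
      = b^-1 * (14 / 3 * delta x0 / T%:R).
    by rewrite /b; field; rewrite ?gt_eqF.
  (* The noise constant is 2/3 * 18/7 = 12/7, rounded up to 2. *)
  rewrite mulrDr lerD2l ler_pdivrMl// /b /c.
  have : 0 <= gamma ^+ 3 * L ^+ 2 * n%:R ^+ 2 * B ^+ 2.
    apply: mulr_ge0 (sqr_ge0 _); apply: mulr_ge0 (sqr_ge0 _).
    by apply: mulr_ge0 (sqr_ge0 _); rewrite exprn_ge0// ltW.
  lra.
move=> A_eq0 mu mu0 PL; cbv zeta; set kappa := L / mu.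
rewrite (expectation_rr_iter _ _ _ p_unif (leqnn T) delta0) lee_fin.
rewrite -/M -/(delta x0).
set N := gamma ^+ 2 * kappa * L * n%:R * B ^+ 2.
have N0 : 0 <= N.
  rewrite /N /kappa; apply: mulr_ge0 (sqr_ge0 _).
  by rewrite !mulr_ge0 ?invr_ge0 ?sqr_ge0// ltW.
(* When [delta] vanishes identically, [mu] may exceed [L] and the rate may be negative, but its
   power is then multiplied by 0. Otherwise a point with positive [delta] compares [mu] with [L]. *)
have [/existsNP[y /eqP dy]|dz] := pselect (~ forall y, delta y = 0); last first.
  have {}dz y : delta y = 0 by move/contrapT: dz.
  rewrite dz mulr0 add0r (le_trans _ N0)//.
  by rewrite /M (_ : delta = fun=> 0) ?rr_mean_cst//; apply/funext.
have muL : mu <= L.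
  have := le_trans (PL y) (smooth_grad_sqr_le y L_gt0 favg_smooth favg_ge).
  have dy0 : 0 < delta y by rewrite lt_def dy delta0.
  by rewrite -!mulrA ler_pM2l// ler_pM2r.
have gmn0 : 0 <= gamma * mu * n%:R by rewrite !mulr_ge0// ltW.
have gmn1 : 2 * (gamma * mu * n%:R) <= 1.
  apply: le_trans g1; rewrite -!mulrA ler_pM2l// ler_pM2l// ler_pM2r//.
rewrite -M0.
(* The contraction factor is [1 - 2 * b * mu], which is nonnegative by [gmn1]. The noise [c] is 2/3
   of [gamma * mu * n%:R * N], below the fraction 7/9 gained by contraction, so [N] satisfies the
   required inequality. *)
apply: (@recursion_contract_le _ _ (1 - 7 / 9 * (gamma * mu * n%:R)) _ c _ T) => //.
- by lra.
- by lra.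
- have cN : c = 2 / 3 * (gamma * mu * n%:R) * N.
    by rewrite /c /N /kappa; field; rewrite gt_eqF.
  by rewrite cN; have := mulr_ge0 gmn0 N0; lra.
- move=> t tT; have := rec t tT; rewrite /a A_eq0 mulr0 addr0 mul1r.
  have : M (fun y => 2 * mu * delta y) t <= M G t by apply: rr_mean_le.
  rewrite /M rr_meanZ -/M => /(ler_wpM2l (ltW b0)).
  rewrite /b; lra.
Qed.
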